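(* Let $X$ and $X'$ be graphs without bridges and fix $D_1\in \mathrm{Pic}^1(X)$ and $D_1'\in \mathrm{Pic}^1(X')$. Let $\phi:J_{X'}\to J_X$ be a group isomorphism such that for all characters $\chi:J_X\to\mathbb{C}^\times$, $$L(t,u,X,\chi,D_1)=L(t,u,X',\chi\circ\phi,D_1').$$ Then the Laplacian lattices of $X$ and $X'$ coincide for a certain ordering of the vertices; that is, $|V(X)|=|V(X')|=n$ for some $n$, and there are orderings of $V(X)$ and of $V(X')$ such that, with respect to these orderings, $\mathrm{im}(L_X)=\mathrm{im}(L_{X'})$ as subgroups of $\mathbb{Z}^n$.
   Context: Throughout, ''graph'' means an undirected, connected, finite multigraph without loops. For a graph $X$, $V(X)$ and $E(X)$ are its vertex and edge sets. A bridge is an edge whose removal disconnects the graph. For an ordering $v_1,\dots,v_n$ of $V(X)$, the Laplacian matrix is $L_X=D_X-A_X$, where $D_X$ is the diagonal matrix of vertex degrees and $A_X$ is the adjacency matrix (counting edges with multiplicity). $\mathrm{Div}(X)$ is the free abelian group on $V(X)$ (identified with $\mathbb{Z}^n$ via the ordering); its elements are called divisors. The degree of $D=\sum a_iv_i$ is $\deg(D)=\sum a_i$. $D$ is effective if all $a_i\ge 0$; $\mathrm{Div}_+(X)$ is the set of effective divisors. The Laplacian lattice of $X$ is $\mathrm{im}(L_X)$, the image of $L_X$ as a $\mathbb{Z}$-endomorphism of $\mathrm{Div}(X)$. The Picard group is $\mathrm{Pic}(X)=\mathrm{Div}(X)/\mathrm{im}(L_X)$; the degree is well defined on it. $\mathrm{Pic}^k(X)$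 is the set of classes of degree $k$, and $J_X=\mathrm{Pic}^0(X)$ is the Jacobian, a finite abelian group. Write $D\sim D'$ if $D,D'$ have the same class, and $|D|$ for the set of effective divisors equivalent to $D$. The Riemann--Roch structure is $h(D)=\min\{\deg(E): E\in\mathrm{Div}_+(X),\ |D-E|=\emptyset\}$. It depends only on the class of $D$, so $h$ is a function on $\mathrm{Pic}(X)$ with values in $\{0,1,2,\dots\}$; $h(D)=0$ if and only if $D$ is not equivalent to an effective divisor. For $D_1\in\mathrm{Pic}^1(X)$ and a character $\chi:J_X\to\mathbb{C}^\times$, the $L$-function is the formal power series in $t$ with coefficients in $\mathbb{C}[u]$ $$L(t,u,X,\chi,D_1)=\sum_{D\in\mathrm{Pic}(X)}\frac{u^{h(D)}-1}{u-1}\,\chi(D-\deg(D)D_1)\,t^{\deg(D)},$$ where $\frac{u^m-1}{u-1}=1+u+\dots+u^{m-1}$ (equal to $0$ when $m=0$). *)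

(* Defs.v *)
From HB Require Import structures.
From mathcomp Require Import all_boot all_order all_algebra.
From mathcomp Require Import complex.
From mathcomp Require Import boolp classical_sets functions cardinality fsbigop.
From mathcomp Require Import reals.

Set Implicit Arguments.
Unset Strict Implicit.
Unset Printing Implicit Defensive.

Import Order.TTheory GRing.Theory Num.Theory.
Local Open Scope ring_scope.
Local Open Scope quotient_scope.

(* [S] is the set of edges that are kept: the spanning subgraph with edge set
   [S] is connected. *)
Definition connected_by (V E : finType) (ends : E -> {set V}) (S : {set E}) :=
  [forall x, forall y,
    connect (fun a b => [exists e in S, ends e == [set a; b]]) x y].

(* An edge has two distinct ends (no loops); different edges may have the same
   ends. Connected graphs are nonempty. *)
Record graph := Graph {
  vert : finType;
  edge : finType;
  ends : edge -> {set vert};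
  no_loop : forall e, #|ends e| = 2%N;
  vert_gt0 : (0 < #|vert|)%N;
  graph_connected : connected_by ends [set: edge]
}.

Definition bridge (X : graph) (e : edge X) : bool :=
  ~~ connected_by (@ends X) [set~ e].

Definition bridgeless (X : graph) : Prop := forall e : edge X, ~~ bridge e.

Definition vdeg (X : graph) (v : vert X) : nat :=
  #|[set e : edge X | v \in ends e]|.

Definition adj (X : graph) (v w : vert X) : nat :=
  #|[set e : edge X | ends e == [set v; w]]|.

Definition lap_entry (X : graph) (v w : vert X) : int :=
  (vdeg v)%:Z *+ (v == w) - (adj v w)%:Z.

Definition lap_mx (X : graph) n (s : 'I_n -> vert X) : 'M[int]_n :=
  \matrix_(i, j) lap_entry (s i) (s j).

Definition lap_lattice (X : graph) n (s : 'I_n -> vert X) : set 'cV[int]_n :=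
  range (fun x : 'cV[int]_n => lap_mx s *m x).

Definition div (X : graph) := {ffun vert X -> int}.
HB.instance Definition _ (X : graph) := GRing.Zmodule.on (div X).

Definition lap (X : graph) (D : div X) : div X :=
  [ffun v => \sum_w lap_entry v w * D w].

Definition deg (X : graph) (D : div X) : int := \sum_v D v.

Definition effective (X : graph) (D : div X) : Prop := forall v, 0 <= D v.

Lemma lapB (X : graph) : {morph @lap X : D D' / D - D'}.
Proof.
move=> D D'; apply/ffunP => v; rewrite !ffunE -sumrB.
by apply: eq_bigr => w _; rewrite !ffunE mulrBr.
Qed.

Lemma degB (X : graph) : {morph @deg X : D D' / D - D'}.
Proof.
by move=> D D'; rewrite /deg -sumrB; apply: eq_bigr => v _; rewrite !ffunE.
Qed.
HB.instance Definition _ (X : graph) :=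
  GRing.isZmodMorphism.Build (div X) int (@deg X) (@degB X).

Lemma lap_lattice_div (X : graph) n (s : 'I_n -> vert X) (D : div X) :
  bijective s ->
  (lap_lattice s (\col_i D (s i))) <-> exists D' : div X, lap D' = D.
Proof.
case=> r sK rK; split=> [[x _ xE]|[D' <-]].
  exists [ffun v => x (r v) 0]; apply/ffunP => v; rewrite ffunE.
  move/colP/(_ (r v)): xE; rewrite !mxE rK => <-.
  rewrite (reindex s) /=; last by exists r => ? _.
  by apply: eq_bigr => i _; rewrite ffunE !mxE rK sK.
exists (\col_i D' (s i)) => //; apply/colP => i; rewrite !mxE ffunE.
rewrite [RHS](reindex s) /=; last by exists r => ? _.
by apply: eq_bigr => j _; rewrite !mxE.
Qed.

Lemma handshake (X : graph) (w : vert X) :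
  (\sum_v adj v w = vdeg w)%N.
Proof.
rewrite /vdeg -sum1_card.
transitivity (\sum_v \sum_(e : edge X | ends e == [set v; w]) 1)%N.
  by apply: eq_bigr => v _; rewrite sum1_card /adj; apply: eq_card => e; rewrite !inE.
rewrite (exchange_big_dep (fun e => w \in ends e)) /=; last first.
  by move=> v e _ /eqP ->; rewrite !inE eqxx orbT.
apply: eq_big => [e|e we]; first by rewrite inE.
have /eqP/cards2P [a [b [ab eE]]] := no_loop e.
wlog wb : a b ab eE / w = b.
  move=> H; have: w \in [set a; b] by rewrite -eE.
  rewrite !inE => /orP[/eqP wa|/eqP]; last exact: (H a b ab eE).
  by apply: (H b a); rewrite 1?eq_sym // eE finset.setUC.
rewrite (big_pred1 a) // => v; rewrite eE wb.
apply/eqP/eqP => [/setP/(_ a)|-> //]; rewrite !inE eqxx /= (negbTE ab) orbF.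
by move/esym/eqP.
Qed.

Lemma deg_lap (X : graph) (D : div X) : deg (lap D) = 0.
Proof.
rewrite /deg.
transitivity (\sum_w \sum_(v : vert X) lap_entry v w * D w).
  by rewrite exchange_big; apply: eq_bigr => v _; rewrite ffunE.
apply: big1 => w _; rewrite -mulr_suml.
suff -> : \sum_v lap_entry v w = 0 by rewrite mul0r.
rewrite sumrB (bigD1 w) //= eqxx mulr1n big1; last first.
  by move=> v /negbTE ->.
by rewrite addr0 -handshake (big_morph Posz PoszD (erefl _)) subrr.
Qed.

Definition principal (X : graph) : {pred div X} :=
  fun D => `[< exists D' : div X, lap D' = D >].

Lemma principal_zmod_closed (X : graph) : zmod_closed (@principal X).
Proof.
split=> [|D E /asboolP[D' <-] /asboolP[E' <-]]; apply/asboolP.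
  by exists 0; have := lapB (0 : div X) 0; rewrite !subrr.
by exists (D' - E'); rewrite lapB.
Qed.
HB.instance Definition _ (X : graph) :=
  GRing.isZmodClosed.Build (div X) (@principal X) (@principal_zmod_closed X).

Definition lequiv (X : graph) (D D' : div X) : Prop := D - D' \in @principal X.

Definition pic (X : graph) := Quotient.quot (@principal X).
HB.instance Definition _ (X : graph) := GRing.Zmodule.on (pic X).
HB.instance Definition _ (X : graph) := ZmodQuotient.on (pic X).

Definition picdeg (X : graph) (c : pic X) : int := deg (repr c).

Lemma deg_lequiv (X : graph) (D D' : div X) : lequiv D D' -> deg D = deg D'.
Proof. by case/asboolP=> F FE; apply/subr0_eq; rewrite -degB -FE deg_lap. Qed.

Lemma lequiv_pi (X : graph) (D D' : div X) :
  lequiv D D' <-> \pi_(pic X) D = \pi_(pic X) D'.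
Proof. by rewrite /lequiv Quotient.idealrBE; split=> /eqP. Qed.

Lemma lequiv_repr (X : graph) (D : div X) : lequiv (repr (\pi_(pic X) D)) D.
Proof. by apply/lequiv_pi; rewrite reprK. Qed.

Lemma picdeg_pi (X : graph) (D : div X) : picdeg (\pi_(pic X) D) = deg D.
Proof. exact/deg_lequiv/lequiv_repr. Qed.

Lemma picdegB (X : graph) : {morph @picdeg X : c d / c - d}.
Proof.
move=> c d; rewrite -[c]reprK -[d]reprK -[X in picdeg X = _]raddfB.
by rewrite !picdeg_pi degB.
Qed.
HB.instance Definition _ (X : graph) :=
  GRing.isZmodMorphism.Build (pic X) int (@picdeg X) (@picdegB X).

Definition pic0 (X : graph) : {pred pic X} := fun c => picdeg c == 0.

Lemma pic0_zmod_closed (X : graph) : zmod_closed (@pic0 X).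
Proof.
split=> [|c d /eqP c0 /eqP d0]; first by rewrite unfold_in raddf0.
by rewrite unfold_in picdegB c0 d0 subrr.
Qed.
HB.instance Definition _ (X : graph) :=
  GRing.isZmodClosed.Build (pic X) (@pic0 X) (@pic0_zmod_closed X).

Record jac (X : graph) := Jac { jac_val :> pic X; jacP : jac_val \in @pic0 X }.
HB.instance Definition _ (X : graph) := [isSub for @jac_val X].
HB.instance Definition _ (X : graph) := [Choice of jac X by <:].
HB.instance Definition _ (X : graph) := [SubChoice_isSubZmodule of jac X by <:].

Record pic1 (X : graph) :=
  Pic1 { pic1_val :> pic X; pic1P : picdeg pic1_val = 1 }.

Lemma jac_shift_subproof (X : graph) (D1 : pic1 X) (D : pic X) :
  D - pic1_val D1 *~ picdeg D \in @pic0 X.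
Proof. by rewrite unfold_in raddfB raddfMz /= pic1P intz subrr. Qed.

Definition jac_shift (X : graph) (D1 : pic1 X) (D : pic X) : jac X :=
  Jac (jac_shift_subproof D1 D).

Definition linsys (X : graph) (D : div X) : set (div X) :=
  [set E | effective E /\ lequiv E D]%classic.

Definition rr_pred (X : graph) (D : div X) : pred nat := fun m =>
  `[< exists E : div X,
        [/\ effective E, deg E = m%:Z & linsys (D - E) = set0] >].

Lemma linsys_neg (X : graph) (D : div X) : deg D < 0 -> linsys D = set0.
Proof.
move=> D0; rewrite -subset0 => E [E0 /deg_lequiv ED].
by move: D0; rewrite -ED ltNge sumr_ge0.
Qed.

Lemma rr_exists (X : graph) (D : div X) : exists m, rr_pred D m.
Proof.
have /card_gt0P[v _] := vert_gt0 X.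
exists `|deg D|.+1; apply/asboolP.
pose E : div X := [ffun w => (`|deg D|.+1)%:Z *+ (w == v)].
have dE : deg E = (`|deg D|.+1)%:Z.
  rewrite /deg (bigD1 v) //= ffunE eqxx big1 ?addr0 // => w /negbTE wv.
  by rewrite ffunE wv.
exists E; split=> //; first by move=> w; rewrite ffunE; case: eqP.
apply: linsys_neg; rewrite degB dE subr_lt0.
by rewrite (le_lt_trans (ler_norm _)) // -abszE ltz_nat.
Qed.

Definition rr (X : graph) (D : div X) : nat := ex_minn (rr_exists D).

Lemma rr_lequiv (X : graph) (D D' : div X) : lequiv D D' -> rr D = rr D'.
Proof.
move=> DD'; apply: eq_ex_minn => m.
suff H (E : div X) : linsys (D - E) = linsys (D' - E).
  by apply/asboolP/asboolP => -[E [E0 Em DE]]; exists E; split=> //; rewrite -DE H.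
have /lequiv_pi e : lequiv (D - E) (D' - E).
  by apply/lequiv_pi; rewrite !raddfB; congr (_ - _); apply/lequiv_pi.
by apply/seteqP; split=> F [F0 /lequiv_pi FE]; split=> //; apply/lequiv_pi;
  rewrite FE e.
Qed.

Definition rrpic (X : graph) (c : pic X) : nat := rr (repr c).

Lemma rrpic_pi (X : graph) (D : div X) : rrpic (\pi_(pic X) D) = rr D.
Proof. exact/rr_lequiv/lequiv_repr. Qed.

Lemma rr_eq0 (X : graph) (D : div X) : rr D = 0%N <-> linsys D = set0.
Proof.
rewrite /rr; case: ex_minnP => m /asboolP[E [E0 Em DE]] mmin; split=> [m0|D0].
  suff E00 : E = 0 by rewrite E00 subr0 in DE.
  move: Em; rewrite m0 => /eqP; rewrite psumr_eq0 // => /allP Ev.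
  by apply/ffunP => v; rewrite ffunE; apply/eqP/Ev/mem_index_enum.
apply/eqP; rewrite -leqn0; apply/mmin/asboolP; exists 0; split.
- by move=> v; rewrite ffunE.
- by rewrite raddf0.
- by rewrite subr0.
Qed.

Record jac_char (R : realType) (X : graph) := JacChar {
  char_val :> jac X -> R[i];
  char_neq0 : forall a, char_val a != 0;
  charD : forall a b, char_val (a + b) = char_val a * char_val b
}.

Lemma char_comp_neq0 (R : realType) (X X' : graph) (chi : jac_char R X)
  (phi : {additive jac X' -> jac X}) a : (chi \o phi) a != 0.
Proof. exact: char_neq0. Qed.

Lemma char_compD (R : realType) (X X' : graph) (chi : jac_char R X)
  (phi : {additive jac X' -> jac X}) a b :
  (chi \o phi) (a + b) = (chi \o phi) a * (chi \o phi) b.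
Proof. by rewrite /= raddfD charD. Qed.

Definition char_comp (R : realType) (X X' : graph) (chi : jac_char R X)
  (phi : {additive jac X' -> jac X}) : jac_char R X' :=
  JacChar (char_comp_neq0 chi phi) (char_compD chi phi).

Definition Lterm (R : realType) (X : graph) (chi : jac_char R X) (D1 : pic1 X)
  (D : pic X) : {poly R[i]} :=
  chi (jac_shift D1 D) *: \sum_(i < rrpic D) 'X^i.

(* The formal power series is given by its sequence of coefficients, the
   polynomial variable being u: [Lfun chi D1 k] is the coefficient of t^k, i.e.
   the sum of the terms of degree k. [Lterm_neg] shows that no term of negative
   degree is lost, and [Lterm_finite] that the sums (which are 0 by convention
   if the support is infinite) are genuine finite sums. *)
Definition Lfun (R : realType) (X : graph) (chi : jac_char R X) (D1 : pic1 X)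
  (k : nat) : {poly R[i]} :=
  \sum_(D \in [set D : pic X | picdeg D = k%:Z]%classic) Lterm chi D1 D.

Lemma Lterm_neg (R : realType) (X : graph) (chi : jac_char R X) (D1 : pic1 X)
  (D : pic X) : picdeg D < 0 -> Lterm chi D1 D = 0.
Proof. by move=> /linsys_neg/rr_eq0 D0; rewrite /Lterm /rrpic D0 big_ord0 scaler0. Qed.

Lemma Lterm_finite (R : realType) (X : graph) (chi : jac_char R X)
  (D1 : pic1 X) (k : nat) :
  finite_set ([set D : pic X | picdeg D = k%:Z] `&`
              Lterm chi D1 @^-1` [set~ 0])%classic.
Proof.
pose g (f : {ffun vert X -> 'I_k.+1}) : pic X :=
  \pi_(pic X) ([ffun v => (f v)%:Z] : div X).
apply: (@sub_finite_set _ _ (range g)); last first.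
  exact/finite_image/finite_finset.
move=> D [dD /= nz].
have [E [E0 ED]] : (linsys (repr D) !=set0)%classic.
  apply/set0P/eqP => /rr_eq0 D0; apply: nz.
  by rewrite /Lterm /rrpic D0 big_ord0 scaler0.
have Ek v : (`|E v| < k.+1)%N.
  rewrite ltnS -lez_nat abszE (ger0_norm (E0 v)) -dD /picdeg -(deg_lequiv ED).
  by rewrite /deg (bigD1 v) //= lerDl sumr_ge0.
exists [ffun v => Ordinal (Ek v)] => //.
rewrite -[D]reprK /g; move/lequiv_pi: ED => <-; congr (\pi_(pic X) _).
by apply/ffunP => v; rewrite !ffunE /= abszE ger0_norm.
Qed.

(* Main.v *)
Require Import Defs.
From mathcomp Require Import all_boot all_order all_algebra.
From mathcomp Require Import complex cyclic separable cyclotomic.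
From mathcomp Require Import boolp classical_sets functions cardinality fsbigop.
From mathcomp Require Import reals.

Set Implicit Arguments.
Unset Strict Implicit.
Unset Printing Implicit Defensive.

Import Order.TTheory GRing.Theory Num.Theory.
Local Open Scope classical_set_scope.
Local Open Scope ring_scope.
Local Open Scope quotient_scope.

(** The Laplacian lattice is the kernel of the map Z^V -> Pic(X), so it is
    determined by the classes of the vertices in Pic(X); equivalently, by the
    degree together with the Abel-Jacobi map v |-> [v] - D_1 into the Jacobian
    ([principal_abel]). The coefficient of t^1 u^0 of the L-function is enough
    to recover the image of that map up to phi.

    Indeed this coefficient is the sum of chi([D] - D_1) over the classes D of
    degree 1 with h(D) > 0, which are the classes of effective divisors of
    degree 1, that is, of vertices. In a graph without bridges two distinct
    vertices are never equivalent ([vdiv_lequiv_inj]), by a maximum principle: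
    if v - w = L f, then the flow of f out of the set where f is maximal is at
    least the number of edges leaving that set, hence at least 2, while it is
    at most 1 because v contributes at most 1 and w nothing positive. So every
    vertex is counted exactly once ([Lfun1_coef0]), and the hypothesis says
    that sum_v chi([v] - D_1) = sum_v' chi(phi([v'] - D_1')) for all chi.

    Characters separate the points of the Jacobian ([jac_char_separates]): the
    Smith normal form writes Pic(X) as a product of cyclic groups, each of
    which embeds in the multiplicative group of the complex numbers. By
    Dedekind's argument, evaluations at distinct points are therefore linearly
    independent functions of chi ([jac_char_independent]). Consequently the
    sets of the [v] - D_1 and of the phi([v'] - D_1') are equal, which yields
    a bijection tau : V(X) -> V(X') that carries one Abel-Jacobi map to the
    other, and therefore one lattice to the other
    ([matching_abel_lattice]). *)

(** * Vertices of a bridgeless graph are pairwise inequivalent *)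

Lemma adjC (X : graph) (v w : vert X) : adj v w = adj w v.
Proof. by rewrite /adj finset.setUC. Qed.

(** The Laplacian as a divergence: its value at x is the total flow of the
    potential f out of x. *)
Lemma lapE (X : graph) (f : div X) (x : vert X) :
  lap f x = \sum_y (adj x y)%:Z * (f x - f y).
Proof.
rewrite ffunE; under eq_bigr do rewrite /lap_entry mulrBl.
rewrite sumrB (bigD1 x) //= eqxx mulr1n big1 ?addr0; last first.
  by move=> y yx; rewrite eq_sym (negbTE yx) mul0r.
rewrite -handshake (big_morph Posz PoszD (erefl _)) mulr_suml -sumrB.
by apply: eq_bigr => y _; rewrite adjC mulrBr.
Qed.

Lemma connected_by_cut (V E : finType) (ends : E -> {set V}) (S : {set E})
    (A : {set V}) (x y : V) :
  connected_by ends S -> x \in A -> y \notin A ->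
  exists e a b, [/\ e \in S, a \in A, b \notin A & ends e = [set a; b]%SET].
Proof.
move=> /forallP/(_ x)/forallP/(_ y) xy xA yA; apply: contrapT => noe.
have Acl : closed (fun a b => [exists e in S, ends e == [set a; b]%SET]) A.
  move=> a b /exists_inP[e eS /eqP eE]; apply/idP/idP => [aA|bA].
    by apply: contraT => bA; case: noe; exists e, a, b.
  apply: contraT => aA; case: noe; exists e, b, a; split=> //.
  by rewrite finset.setUC.
by move: yA; rewrite -(closed_connect Acl xy) xA.
Qed.

(** Connectedness gives an edge leaving A; since that edge is not a bridge, the
    graph without it is still connected and gives another one. *)
Lemma bridgeless_cut (X : graph) (A : {set vert X}) (x y : vert X) :
  bridgeless X -> x \in A -> y \notin A ->
  (2 <= \sum_(a in A) \sum_(b in ~: A) adj a b)%N.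
Proof.
move=> hX xA yA.
have [e1 [a1 [b1 [_ a1A b1A e1E]]]] :=
  connected_by_cut (graph_connected X) xA yA.
have /negPn hX1 := hX e1.
have [e2 [a2 [b2 [e12 a2A b2A e2E]]]] := connected_by_cut hX1 xA yA.
rewrite !inE in e12.
rewrite pair_big /=.
under eq_bigr do rewrite /adj -sum1_card.
rewrite (exchange_big_dep xpredT) //= (bigD1 e1) //= (bigD1 e2) //= addnA.
apply: leq_trans (leq_addr _ _); rewrite -[2%N]/(1 + 1)%N.
by apply: leq_add; [rewrite (bigD1 (a1, b1))|rewrite (bigD1 (a2, b2))];
  rewrite //= !inE ?a1A ?a2A ?b1A ?b2A /= ?e1E ?e2E.
Qed.

Definition vdiv (X : graph) (v : vert X) : div X := [ffun w => (w == v)%:Z].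

(** Maximum principle: if [v] - [w] = lap f, sum lap f over the set A on which f
    is maximal. The edges inside A cancel, and each of the at least two edges
    leaving A contributes at least 1, whereas [v] - [w] has sum at most 1 on
    A. *)
Lemma vdiv_lequiv_inj (X : graph) (v w : vert X) :
  bridgeless X -> lequiv (vdiv v) (vdiv w) -> v = w.
Proof.
move=> hX /asboolP[f fE]; apply/eqP; apply: contraT => vw.
have lapf x : lap f x = (x == v)%:Z - (x == w)%:Z by rewrite fE !ffunE.
have [m fm] : exists m, forall y, f y <= f m.
  by exists [arg max_(i > v) f i]%O; case: arg_maxP => // i _ H y; apply: H.
pose A := [set x | f x == f m]%SET.
have [y yA] : exists y, y \notin A.
  apply: contrapT => noy.
  have fc y : f y = f m.
    by apply/eqP; apply: contraT => H; case: noy; exists y; rewrite inE.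
  have := lapf v; rewrite eqxx (negbTE vw) lapE big1 // => y _.
  by rewrite !fc subrr mulr0.
have mA : m \in A by rewrite inE.
(* Inside A the potential is constant; across the cut it drops by a positive
   integer, and no edge has a negative contribution. *)
have lo : ((\sum_(a in A) \sum_(b in ~: A) adj a b)%N)%:Z
    <= \sum_(a in A) lap f a.
  rewrite (big_morph Posz PoszD (erefl _)); apply: ler_sum => a aA.
  have {}aA : f a = f m by move: aA; rewrite inE => /eqP.
  rewrite lapE aA (big_morph Posz PoszD (erefl _)) big_mkcond /=.
  apply: ler_sum => b _; rewrite !inE; case: ifPn => bA.
    by rewrite ler_peMr // -gtz0_ge1 subr_gt0 lt_neqAle bA fm.
  by rewrite mulr_ge0 // subr_ge0 fm.
have hi : \sum_(a in A) lap f a <= 1.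
  under eq_bigr do rewrite lapf.
  rewrite sumrB.
  have S u : \sum_(a in A) (a == u)%:Z = (u \in A)%:Z.
    case: (boolP (u \in A)) => uA; last first.
      by rewrite big1 // => a aA; case: eqP => // au; rewrite -au aA in uA.
    by rewrite (bigD1 u) //= eqxx big1 ?addr0 // => a /andP[_ /negbTE ->].
  by rewrite !S; do 2!case: (_ \in A).
have := le_trans lo hi; rewrite lez_nat leqNgt.
by rewrite (bridgeless_cut hX mA yA).
Qed.

(** * Characters separate the points of the Jacobian *)

(** In characteristic 0 the polynomial X^n - 1 is separable, so it has n distinct
    roots, and a group of n roots of unity of order n in a field is cyclic. *)
Lemma prim_root_exists (C : numClosedFieldType) (n : nat) :
  (0 < n)%N -> exists z : C, n.-primitive_root z.
Proof.
move=> n0; have [r rE] := closed_field_poly_normal ('X^n - 1 : {poly C}).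
have lc : lead_coef ('X^n - 1 : {poly C}) = 1.
  by apply/monicP; apply: monicXnsubC.
rewrite lc scale1r in rE.
have ru : uniq r.
  rewrite -separable_prod_XsubC -rE; apply: separable_Xn_sub_1.
  by rewrite pnatr_eq0 -lt0n.
have rs : size r = n.
  by apply: succn_inj; rewrite -(size_prod_XsubC r id) -rE size_XnsubC.
have rr : all n.-unity_root r.
  by apply/allP => z zr; rewrite /root_of_unity rE root_prod_XsubC.
have /hasP[z _ zP] : has n.-primitive_root r.
  by apply: has_prim_root; rewrite ?rs.
by exists z.
Qed.

(** The group Z/dZ embeds in the units of C, also when d = 0: the image of 1 is a
    primitive d-th root of unity, or 2 when d = 0. *)
Lemma cyclic_group_embeds (C : numClosedFieldType) (d : int) :
  exists2 z : C, z != 0 & forall k : int, (z ^ k == 1) = (d %| k)%Z.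
Proof.
have [->|d0] := eqVneq d 0.
  exists 2; first by rewrite pnatr_eq0.
  by move=> k; rewrite pexprz_eq1 ?ler0n // dvd0z pnatr_eq1 orbF.
have [z zP] := @prim_root_exists C `|d| (ltac:(by rewrite absz_gt0)).
have z0 : z != 0.
  by rewrite (prim_root_eq0 zP) -lt0n absz_gt0.
exists z => // k; rewrite dvdzE (prim_order_dvd zP).
case: k => k //.
by rewrite NegzE abszN -exprnN invr_eq1.
Qed.

(** With the Smith normal form lap_mx = L S R, left multiplication by the inverse
    of L turns the Laplacian lattice into the lattice of the vectors whose j-th
    coordinate is divisible by the j-th invariant factor. The function q is the
    coordinate at which D violates divisibility. *)
Lemma non_principal_coord (X : graph) (D : div X) : D \notin @principal X ->
  exists (d : int) (q : div X -> int),
    [/\ {morph q : E F / E - F},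
        forall E, E \in @principal X -> (d %| q E)%Z
      & ~~ (d %| q D)%Z].
Proof.
set n := #|vert X|; pose s : 'I_n -> vert X := enum_val.
have sbij : bijective s by exists enum_rank; [apply: enum_valK|apply: enum_rankK].
have [L Lu [R Ru [d _ sE]]] := int_Smith_normal_form (lap_mx s).
set S := (\matrix_(i, j) _) in sE.
pose c (E : div X) : 'cV[int]_n := invmx L *m \col_i E (s i).
pose q j (E : div X) : int := c E j 0.
have SE (y : 'cV[int]_n) j : (S *m y) j 0 = d`_j * y j 0.
  rewrite !mxE (bigD1 j) //= !mxE eqxx mulr1n big1 ?addr0 // => i ij.
  by rewrite !mxE eq_sym (inj_eq val_inj) (negbTE ij) mul0r.
have cP (E : div X) : E \in @principal X <-> forall j, (d`_j %| q j E)%Z.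
  split=> [/asboolP/(lap_lattice_div E sbij)[x _ xE] j|H].
    by rewrite /q /c -xE sE -!mulmxA mulKmx // SE dvdz_mulr.
  apply/asboolP/(lap_lattice_div E sbij).
  exists (invmx R *m \col_j (q j E %/ d`_j)%Z) => //=.
  rewrite sE -!mulmxA mulKVmx // -[RHS](mulKVmx Lu); congr (L *m _).
  apply/colP => j; rewrite SE mxE mulrC divzK //.
move=> DP; have [j jP] : exists j, ~~ (d`_j %| q j D)%Z.
  apply: contrapT => noj; move/negP: DP; apply; apply/cP => j.
  by apply: contraT => H; case: noj; exists j.
exists d`_j, (q j); split=> // [E F|E /cP//].
rewrite /q; have -> : c (E - F) = c E - c F.
  by rewrite /c -mulmxBr; congr (_ *m _); apply/colP => i; rewrite !mxE !ffunE.
by rewrite !mxE.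
Qed.

Lemma jac_repr_neq0 (X : graph) (a : jac X) : a != 0 -> repr (val a) \notin @principal X.
Proof.
apply: contraNN => aP; apply/eqP/val_inj => /=.
rewrite -[LHS]reprK; have -> : 0 = \pi_(pic X) (0 : div X) by rewrite raddf0.
by apply/lequiv_pi; rewrite /lequiv subr0.
Qed.

(** A coordinate modulo its invariant factor, followed by an embedding of the
    cyclic group into the units of C. *)
Lemma jac_char_separates0 (R : realType) (X : graph) (a : jac X) : a != 0 ->
  exists chi : jac_char R X, chi a != 1.
Proof.
move=> /jac_repr_neq0/non_principal_coord[d [q [qB qP qa]]].
have [z z0 zP] := cyclic_group_embeds (R[i] : numClosedFieldType) d.
have q0 : q 0 = 0 by rewrite -[X in q X](subrr 0) qB subrr.
have qN E : q (- E) = - q E by rewrite -sub0r qB q0 sub0r.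
have qD E F : q (E + F) = q E + q F by rewrite -[F in LHS]opprK qB qN opprK.
pose chi (b : jac X) : R[i] := z ^ q (repr (val b)).
have chi0 b : chi b != 0 by rewrite expfz_neq0.
have chiD b c : chi (b + c) = chi b * chi c.
  rewrite /chi -expfzDr // -qD.
  set E := repr (val (b + c)); set F := _ + _.
  have EF : E - F \in @principal X.
    apply/lequiv_pi; rewrite raddfD /= !reprK //.
  have := qP _ EF; rewrite -zP qB => /eqP H.
  by rewrite -[q E](subrK (q F)) expfzDr // H mul1r.
by exists (JacChar chi0 chiD); rewrite /= /chi zP.
Qed.

Lemma jac_char_separates (R : realType) (X : graph) (a b : jac X) : a != b ->
  exists chi : jac_char R X, chi a != chi b.
Proof.
rewrite -subr_eq0 => /(jac_char_separates0 R)[chi chiab]; exists chi.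
apply: contra_neq chiab => ab; apply: (mulIf (char_neq0 chi b)).
by rewrite -charD subrK mul1r.
Qed.

(** * Character sums determine finite subsets of the Jacobian *)

Definition char1 (R : realType) (X : graph) : jac_char R X :=
  @JacChar R X (fun=> 1) (fun=> oner_neq0 _) (fun _ _ => esym (mulr1 1)).

Lemma char_mul_neq0 (R : realType) (X : graph) (chi psi : jac_char R X) a :
  chi a * psi a != 0.
Proof. by rewrite mulf_neq0 ?char_neq0. Qed.

Lemma char_mulD (R : realType) (X : graph) (chi psi : jac_char R X) a b :
  chi (a + b) * psi (a + b) = chi a * psi a * (chi b * psi b).
Proof. by rewrite !charD mulrACA. Qed.

Definition char_mul (R : realType) (X : graph) (chi psi : jac_char R X) :=
  JacChar (char_mul_neq0 chi psi) (char_mulD chi psi).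

(** Dedekind's argument: a relation involving a and b, twisted by a character
    chi0 with chi0 a <> chi0 b and combined with the original relation, loses
    its term at b but keeps the one at a. *)
Lemma jac_char_independent (R : realType) (X : graph) (s : seq (jac X))
    (f : jac X -> R[i]) :
  uniq s -> (forall chi : jac_char R X, \sum_(a <- s) f a * chi a = 0) ->
  forall a, a \in s -> f a = 0.
Proof.
elim: s f => // b s IHs f /= /andP[bs us] sum0.
have f0 a : a \in s -> f a = 0.
  move=> a_s; have ab : a != b by apply: contraNneq bs => <-.
  have [chi0 chi0ab] := jac_char_separates R ab.
  suff : f a * (chi0 a - chi0 b) = 0.
    by move/eqP; rewrite mulf_eq0 subr_eq0 (negbTE chi0ab) orbF => /eqP.
  apply: (IHs (fun x => f x * (chi0 x - chi0 b))) => // chi.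
  have : \sum_(x <- b :: s) f x * char_mul chi0 chi x
      = chi0 b * \sum_(x <- b :: s) f x * chi x by rewrite !sum0 mulr0.
  rewrite !big_cons mulrDr /= [in RHS]mulrCA => /addrI/eqP.
  rewrite mulr_sumr -subr_eq0 -sumrB => /eqP diff0.
  rewrite -[RHS]diff0.
  by apply: eq_bigr => x _; rewrite mulrBr mulrBl; congr (_ - _);
    rewrite -!mulrA // mulrCA.
move=> a; rewrite inE => /predU1P[->|/f0//].
have := sum0 (char1 R X); rewrite big_cons mulr1 big_seq big1 ?addr0 //.
by move=> x xs; rewrite f0 // mul0r.
Qed.

(** Grouping the indices with the same value, both sides are combinations of
    evaluations at the points of s, whose coefficients are multiplicities;
    independence makes the multiplicities agree, and that of u i is positive
    on the left. *)
Lemma char_sums_determine (R : realType) (X : graph) (I I' : finType)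
    (u : I -> jac X) (u' : I' -> jac X) :
  (forall chi : jac_char R X, \sum_i chi (u i) = \sum_i chi (u' i)) ->
  forall i, exists i', u' i' = u i.
Proof.
move=> sums i.
pose count_at (J : finType) (w : J -> jac X) a : R[i] :=
  \sum_(j | w j == a) 1.
pose s := undup (codom u ++ codom u').
have group (J : finType) (w : J -> jac X) (chi : jac_char R X) :
    {subset codom w <= s} ->
    \sum_(a <- s) count_at J w a * chi a = \sum_j chi (w j).
  move=> ws.
  under eq_bigr do rewrite /count_at mulr_suml.
  rewrite (exchange_big_dep xpredT) //=; apply: eq_bigr => j _.
  under eq_bigl do rewrite eq_sym.
  by rewrite -big_filter filter_pred1_uniq ?undup_uniq ?ws ?codom_f // big_seq1 mul1r.
have us : {subset codom u <= s} by move=> a; rewrite mem_undup mem_cat => ->.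
have us' : {subset codom u' <= s}.
  by move=> a; rewrite mem_undup mem_cat orbC => ->.
have eqc : count_at I u (u i) = count_at I' u' (u i).
  apply/subr0_eq.
  apply: (@jac_char_independent R X s (fun a => count_at I u a - count_at I' u' a)).
  - exact: undup_uniq.
  - move=> chi; under eq_bigr do rewrite mulrBl.
    by rewrite sumrB !group // sums subrr.
  - exact/us/codom_f.
apply: contrapT => noi'; move: eqc; rewrite /count_at [RHS]big1; last first.
  by move=> j /eqP ji; case: noi'; exists j.
rewrite (bigD1 i) //= => /eqP; rewrite paddr_eq0 ?oner_eq0 //.
by apply: sumr_ge0.
Qed.

(** * The Abel-Jacobi map and the Laplacian lattice *)

(** The Abel-Jacobi map with base class D1. *)
Definition abel (X : graph) (D1 : pic1 X) (v : vert X) : jac X :=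
  jac_shift D1 (\pi_(pic X) (vdiv v)).

Lemma vdivE (X : graph) (D : div X) : D = \sum_v vdiv v *~ D v.
Proof.
apply/ffunP => w; rewrite sum_ffunE (bigD1 w) //= big1 ?addr0.
  by rewrite ffunMzE ffunE eqxx intz.
by move=> v vw; rewrite ffunMzE ffunE eq_sym (negbTE vw) mul0rz.
Qed.

Lemma deg_vdiv (X : graph) (v : vert X) : deg (vdiv v) = 1.
Proof.
rewrite /deg (bigD1 v) //= ffunE eqxx big1 ?addr0 // => w /negbTE wv.
by rewrite ffunE wv.
Qed.

Lemma abel_sum (X : graph) (D1 : pic1 X) (D : div X) :
  val (\sum_v abel D1 v *~ D v)
  = \pi_(pic X) D - pic1_val D1 *~ deg D.
Proof.
have valMz (a : jac X) k : val (a *~ k) = val a *~ k by rewrite raddfMz.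
transitivity (\sum_v val (abel D1 v) *~ D v).
  by rewrite raddf_sum; apply: eq_bigr => v _; apply: valMz.
rewrite {2}[D]vdivE raddf_sum mulrz_sumr -sumrB.
apply: eq_bigr => v _; rewrite [in RHS]raddfMz /= picdeg_pi deg_vdiv.
by rewrite mulr1z mulrzBl.
Qed.

(** The degree and the Abel-Jacobi map together determine the class of a divisor,
    since Pic is the direct sum of the Jacobian and the multiples of D1. *)
Lemma principal_abel (X : graph) (D1 : pic1 X) (D : div X) :
  (exists D', lap D' = D) <-> deg D = 0 /\ \sum_v abel D1 v *~ D v = 0.
Proof.
have pi0 : (exists D', lap D' = D) <-> \pi_(pic X) D = 0.
  rewrite -[0](raddf0 \pi_(pic X)); split=> [H|/lequiv_pi].
    by apply/lequiv_pi; rewrite /lequiv subr0; apply/asboolP.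
  by rewrite /lequiv subr0 => /asboolP.
rewrite pi0; split=> [D0|[d0 /(congr1 val)]]; last first.
  by rewrite abel_sum d0 subr0.
have d0 : deg D = 0 by rewrite -picdeg_pi D0 raddf0.
by split=> //; apply: val_inj; rewrite abel_sum D0 d0 subr0.
Qed.

Lemma abel_inj (X : graph) (D1 : pic1 X) : bridgeless X -> injective (abel D1).
Proof.
move=> hX v w /(congr1 val) /=; rewrite !picdeg_pi !deg_vdiv => /addIr vw.
by apply: vdiv_lequiv_inj => //; apply/lequiv_pi.
Qed.

(** * Transporting the lattice *)

(** Under tau the degrees agree, and phi carries the Abel-Jacobi sum of the
    transported divisor to that of the original one; as phi is injective, one
    vanishes exactly when the other does. *)
Lemma matching_abel_lattice (X X' : graph) (D1 : pic1 X) (D1' : pic1 X')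
    (phi : {additive jac X' -> jac X}) (tau : vert X -> vert X')
    n (s : 'I_n -> vert X) :
  injective phi -> bijective tau -> bijective s ->
  (forall v, phi (abel D1' (tau v)) = abel D1 v) ->
  lap_lattice s = lap_lattice (tau \o s).
Proof.
move=> phi_inj tau_bij s_bij tauE.
have [r sK rK] := s_bij; have [sigma tauK sigmaK] := tau_bij.
apply/seteqP; suff H x : lap_lattice s x <-> lap_lattice (tau \o s) x.
  by split=> x /H.
pose D : div X := [ffun v => x (r v) 0].
pose D' : div X' := [ffun v => x (r (sigma v)) 0].
have xD : x = \col_i D (s i) by apply/colP => i; rewrite mxE ffunE sK.
have xD' : x = \col_i D' ((tau \o s) i).
  by apply/colP => i; rewrite mxE ffunE /= tauK sK.
have DD' v : D' (tau v) = D v by rewrite !ffunE tauK.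
rewrite {1}xD xD' !lap_lattice_div //; last exact: bij_comp.
rewrite (principal_abel D1) (principal_abel D1').
have -> : deg D' = deg D.
  by rewrite /deg (reindex tau) /=; [apply: eq_bigr|apply: onW_bij].
have -> : \sum_v abel D1 v *~ D v = phi (\sum_v abel D1' v *~ D' v).
  rewrite raddf_sum [RHS](reindex tau) /=; last exact: onW_bij.
  by apply: eq_bigr => v _; rewrite raddfMz tauE DD'.
by split=> -[? H]; split=> //; [apply: phi_inj; rewrite raddf0|rewrite H raddf0].
Qed.

(** * The coefficient of t u^0 of the L-function *)

Lemma rr_gt0 (X : graph) (D : div X) : (0 < rr D)%N <-> linsys D !=set0.
Proof.
split=> [|[E ED]]; first by rewrite lt0n => H; apply/set0P; apply: contra_neq H => /rr_eq0.
by rewrite lt0n; apply/eqP => /rr_eq0 D0; move: ED; rewrite D0.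
Qed.

Lemma effective_deg1 (X : graph) (D : div X) : effective D -> deg D = 1 ->
  exists v, D = vdiv v.
Proof.
move=> D0 D1; have [v Dv] : exists v, D v != 0.
  apply: contrapT => noD; move: D1; rewrite /deg big1 // => v _.
  by apply/eqP; apply: contraT => H; case: noD; exists v.
have rest : \sum_(w | w != v) D w = 0.
  have : \sum_(w | w != v) D w <= 0.
    rewrite -(lerD2l (D v)) addr0; move: D1; rewrite /deg (bigD1 v) //= => ->.
    by rewrite -gtz0_ge1 lt_neqAle eq_sym Dv D0.
  by move=> le0; apply/eqP; rewrite eq_le le0 sumr_ge0.
exists v; apply/ffunP => w; rewrite ffunE; case: eqP => [->|/eqP wv].
  by move: D1; rewrite /deg (bigD1 v) //= rest addr0.
move/eqP: rest; rewrite psumr_eq0 // => /allP/(_ w (mem_index_enum _)).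
by rewrite wv => /eqP.
Qed.

(** The constant term in u of (u^h - 1)/(u - 1) is 1 if h > 0 and 0 otherwise, so
    only classes of vertices contribute; injectivity of the map from vertices
    to classes is what makes each vertex count once. *)
Lemma Lfun1_coef0 (R : realType) (X : graph) (chi : jac_char R X)
    (D1 : pic1 X) : bridgeless X ->
  (Lfun chi D1 1)`_0 = \sum_v chi (abel D1 v).
Proof.
move=> hX; rewrite /Lfun.
pose c (v : vert X) := \pi_(pic X) (vdiv v).
have c_inj : injective c by move=> v w /lequiv_pi; apply: vdiv_lequiv_inj.
rewrite (@fsbigE _ _ _ _ _ (map c (index_enum (vert X)))).
- rewrite big_map coef_sum; apply: eq_big => v.
    by apply/mem_set; rewrite /= picdeg_pi deg_vdiv.
  move=> _.
  rewrite /Lterm coefZ coef_sum rrpic_pi.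
  have : (0 < rr (vdiv v))%N.
    apply/rr_gt0; exists (vdiv v); split; last exact/lequiv_pi.
    by move=> w; rewrite ffunE; case: eqP.
  case: (rr _) => // m _; rewrite big_ord_recl coefXn eqxx big1 ?addr0 ?mulr1 //.
  by move=> i _; rewrite coefXn.
- by rewrite map_inj_uniq ?index_enum_uniq.
- by move=> D /= /mapP[v _ ->]; rewrite picdeg_pi deg_vdiv.
- move=> D /= dD; apply: contraNeq => nz.
  have : (0 < rr (repr D))%N.
    rewrite lt0n; apply: contra_neq nz => r0.
    by rewrite /Lterm /rrpic r0 big_ord0 scaler0.
  move=> /rr_gt0[E [E0 ED]].
  have [v vE] := effective_deg1 E0 (etrans (deg_lequiv ED) dD).
  by apply/mapP; exists v => //; rewrite /c -vE -[D]reprK; apply/esym/lequiv_pi.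
Qed.

Theorem theorem1 (R : realType) (X X' : graph)
  (hX : bridgeless X) (hX' : bridgeless X')
  (D1 : pic1 X) (D1' : pic1 X')
  (phi : {additive jac X' -> jac X}) (phi_bij : bijective phi)
  (hL : forall chi : jac_char R X,
      Lfun chi D1 = Lfun (char_comp chi phi) D1') :
  exists (n : nat) (s : 'I_n -> vert X) (s' : 'I_n -> vert X'),
    [/\ #|vert X| = n, #|vert X'| = n, bijective s, bijective s'
      & lap_lattice s = lap_lattice s'].
Proof.
have phi_inj := bij_inj phi_bij.
pose u' v' := phi (abel D1' v').
have u'_inj : injective u' by move=> v w /phi_inj; apply: abel_inj.
have sums (chi : jac_char R X) :
    \sum_v chi (abel D1 v) = \sum_v chi (u' v).
  by rewrite -Lfun1_coef0 // hL Lfun1_coef0.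
have [tau tauE] := choice (char_sums_determine sums).
have [sigma sigmaE] := choice (char_sums_determine (fun chi => esym (sums chi))).
have tau_bij : bijective tau.
  exists sigma => v; last by apply: u'_inj; rewrite tauE sigmaE.
  by apply: (abel_inj (D1 := D1)) => //; rewrite sigmaE tauE.
have s_bij : bijective (@enum_val (vert X) predT).
  by exists enum_rank; [apply: enum_valK|apply: enum_rankK].
exists #|vert X|, enum_val, (tau \o enum_val); split=> //.
- by rewrite (bij_eq_card tau_bij).
- exact: bij_comp.
- exact: matching_abel_lattice phi_inj tau_bij s_bij tauE.
Qed.
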